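(* For every integer $k \ge 5$ there exists a graph $H$ with $Q_{k-1} \subseteq H \subseteq Q_k$ such that there is no $n$ for which the edge set of $Q_n$ can be partitioned into (equivalently, covered by) pairwise edge-disjoint copies of $H$.
   Context: $Q_n$ denotes the $n$-dimensional hypercube: vertex set $\{0,1\}^n$, two vertices adjacent iff they differ in exactly one coordinate. $Q_{k-1} \subseteq H \subseteq Q_k$ means $H$ is a subgraph of $Q_k$ that contains a subgraph isomorphic to $Q_{k-1}$. A copy of $H$ in $Q_n$ is any subgraph of $Q_n$ isomorphic to $H$ (not required to be induced); the copies in the cover must be pairwise edge-disjoint and every edge of $Q_n$ must lie in one of them. *)

(* Defs.v *)
From HB Require Import structures.
From mathcomp Require Import all_boot.

Set Implicit Arguments.
Unset Strict Implicit.
Unset Printing Implicit Defensive.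

(* A finite simple graph with vertices drawn from T: a vertex set together    *)
(* with an edge set whose members are 2-element subsets of the vertex set.    *)
Record graph (T : finType) := Graph {
  graph_val : {set T} * {set {set T}};
  _ : [forall e in graph_val.2, (e \subset graph_val.1) && (#|e| == 2)]
}.

HB.instance Definition _ (T : finType) := [isSub for @graph_val T].
HB.instance Definition _ (T : finType) := [Finite of graph T by <:].

Definition vertices (T : finType) (G : graph T) : {set T} := (graph_val G).1.
Definition edges (T : finType) (G : graph T) : {set {set T}} := (graph_val G).2.

Definition subgraph (T : finType) (G1 G2 : graph T) : bool :=
  (vertices G1 \subset vertices G2) && (edges G1 \subset edges G2).

(* Only the values of f on the vertices of G matter. *)
Definition isomorphic (T U : finType) (G : graph T) (H : graph U) : Prop :=
  exists f : T -> U,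
    [/\ {in vertices G &, injective f},
        f @: vertices G = vertices H
      & {in vertices G &, forall x y,
           ([set x; y] \in edges G) = ([set f x; f y] \in edges H)}].

(* C is a copy of H in G; copies need not be induced. *)
Definition is_copy (T U : finType) (H : graph U) (G C : graph T) : Prop :=
  subgraph C G /\ isomorphic C H.

Definition edge_decomposable (T U : finType) (G : graph T) (H : graph U) : Prop :=
  exists F : {set graph T},
    [/\ forall C, C \in F -> is_copy H G C,
        {in F &, forall C D, C != D -> [disjoint edges C & edges D]}
      & \bigcup_(C in F) edges C = edges G].

Definition cube (n : nat) : finType := {ffun 'I_n -> bool}.

Definition cube_adj (n : nat) (x y : cube n) : bool :=
  #|[set i | x i != y i]| == 1.

Definition cube_edges (n : nat) : {set {set cube n}} :=
  [set e | [exists x, exists y, cube_adj x y && (e == [set x; y])]].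

Lemma cube_edgesP (n : nat) :
  [forall e in cube_edges n, (e \subset [set: cube n]) && (#|e| == 2)].
Proof.
apply/forallP => e; apply/implyP; rewrite inE subsetT /=.
case/existsP => x /existsP [y /andP [adj_xy /eqP ->]].
rewrite cards2; case: (eqVneq x y) adj_xy => [->|] //; rewrite /cube_adj.
rewrite (_ : [set i | _] = set0) ?cards0 //.
by apply/setP => i; rewrite !inE eqxx.
Qed.

Definition hypercube (n : nat) : graph (cube n) :=
  @Graph _ ([set: cube n], cube_edges n) (cube_edgesP n).

(* Main.v *)
(** Take for [H] the cube [Q_k] with all edges at the all-ones vertex removed.
    Opposite edges of a 4-cycle of [Q_n] are parallel, and the remaining edges
    of [Q_k] in a fixed direction are linked to each other by 4-cycles avoiding
    the all-ones vertex; so in a copy of [H] in [Q_n] they all get the same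
    direction. As each direction of [H] has [2^(k-1) - 1] edges, this odd number
    would have to divide the number [2^(n-1)] of edges of [Q_n] in a given
    direction. *)
Require Import Defs.
From mathcomp Require Import all_boot.

Set Implicit Arguments.
Unset Strict Implicit.
Unset Printing Implicit Defensive.

(** * Bit flips and edges of the hypercube *)

Definition flip (n : nat) (i : 'I_n) (x : cube n) : cube n :=
  [ffun j => x j (+) (j == i)].

Lemma flipK (n : nat) (i : 'I_n) : involutive (flip i).
Proof. by move=> x; apply/ffunP => j; rewrite !ffunE -addbA addbb addbF. Qed.

Lemma flipC (n : nat) (i j : 'I_n) (x : cube n) :
  flip i (flip j x) = flip j (flip i x).
Proof. by apply/ffunP => l; rewrite !ffunE addbAC. Qed.

Lemma flip_inj_dir (n : nat) (i j : 'I_n) (x : cube n) :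
  flip i x = flip j x -> i = j.
Proof.
move/ffunP/(_ i); rewrite !ffunE eqxx => /addbI /esym.
by move/eqP.
Qed.

Lemma cube_adjP (n : nat) (x y : cube n) :
  reflect (exists i, y = flip i x) (cube_adj x y).
Proof.
apply: (iffP cards1P) => [[i xyE] | [i ->]]; exists i.
  apply/ffunP => j; rewrite ffunE -in_set1 -xyE inE.
  by case: (x j) (y j) => [] [].
by apply/setP => j; rewrite !inE ffunE; case: (x j) (j == i) => [] [].
Qed.

Lemma cube_adjC (n : nat) (x y : cube n) : cube_adj x y = cube_adj y x.
Proof.
rewrite /cube_adj; congr (#|pred_of_set _| == 1).
by apply/setP => i; rewrite !inE eq_sym.
Qed.

Lemma in_cube_edges (n : nat) (x y : cube n) :
  ([set x; y] \in cube_edges n) = cube_adj x y.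
Proof.
rewrite inE; apply/existsP/idP => [[a /existsP[b /andP[adj_ab /eqP xyE]]] | adj_xy].
  have neq_ab : a != b.
    apply: contraTneq adj_ab => ->; rewrite /cube_adj.
    by rewrite (_ : [set i | _] = set0) ?cards0 //; apply/setP => i; rewrite !inE eqxx.
  have: a \in [set x; y] by rewrite xyE set21.
  have: b \in [set x; y] by rewrite xyE set22.
  case/set2P => Eb /set2P[] Ea; subst a b; rewrite ?eqxx // in neq_ab.
  by rewrite cube_adjC.
by exists x; apply/existsP; exists y; rewrite adj_xy eqxx.
Qed.

Lemma flip_edge (n : nat) (i : 'I_n) (x : cube n) :
  [set x; flip i x] \in cube_edges n.
Proof. by rewrite in_cube_edges; apply/cube_adjP; exists i. Qed.

(** Around the closed walk [a], [flip i a], [c], [d] the bit [i] changes an even number of times.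
    The two inequalities keep both edges next to the first one out of direction [i], so the opposite
    edge must have it. *)
Lemma square_parallel (n : nat) (i : 'I_n) (a c d : cube n) :
  cube_adj a d -> cube_adj (flip i a) c -> cube_adj d c ->
  c != a -> flip i a != d -> c = flip i d.
Proof.
case/cube_adjP=> l -> /cube_adjP[p ->] /cube_adjP[q E] neq_ca neq_bd.
have neq_li : (i == l) = false by apply: contraNF neq_bd => /eqP->.
have neq_pi : (i == p) = false.
  by apply: contraNF neq_ca => /eqP <-; rewrite flipK.
move: (E) => /ffunP/(_ i); rewrite !ffunE eqxx neq_li neq_pi !addbF.
by move=> /addbI /esym/eqP iq; rewrite E -iq.
Qed.

(** * The punctured cube and its parallel classes *)

Definition ones (k : nat) : cube k := [ffun => true].

Definition punctured_edges (k : nat) : {set {set cube k}} :=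
  [set e in cube_edges k | ones k \notin e].

Lemma punctured_edgesP (k : nat) :
  [forall e in punctured_edges k, (e \subset [set: cube k]) && (#|e| == 2)].
Proof.
apply/forall_inP => e /[!inE] /andP[e_edge _].
by move/forall_inP: (cube_edgesP k); apply; rewrite inE.
Qed.

(** The all-ones vertex stays, isolated, so that every copy comes from an injection defined on all
    of [cube k]. *)
Definition punctured_cube (k : nat) : graph (cube k) :=
  @Graph _ ([set: cube k], punctured_edges k) (punctured_edgesP k).

Lemma flip_punctured (k : nat) (j : 'I_k) (u : cube k) :
  ([set u; flip j u] \in edges (punctured_cube k)) =
  (u != ones k) && (flip j u != ones k).
Proof.
by rewrite [edges _]/= in_set flip_edge !inE negb_or !(eq_sym (ones k)).
Qed.

(** Counting ends doubles the 2^(k-1) - 1 edges in direction [j]; the two missing vertices are the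
    ends of the one removed edge. *)
Lemma card_flip_punctured (k : nat) (j : 'I_k) :
  #|[set u | [set u; flip j u] \in edges (punctured_cube k)]| = 2 ^ k - 2.
Proof.
rewrite (_ : [set u | _] = ~: [set ones k; flip j (ones k)]); last first.
  apply/setP => u; rewrite in_set flip_punctured !inE.
  by rewrite (can2_eq (flipK j) (flipK j)) negb_or.
rewrite cardsCs setCK card_ffun card_bool card_ord cards2.
rewrite (_ : ones k != _) //; apply/eqP => /ffunP/(_ j).
by rewrite !ffunE eqxx.
Qed.

(* Switching off the bits of [u] other than [j] one by one never reaches the
   all-ones vertex, so it links the edge [{u, flip j u}] to the one at [0]. *)
Lemma copy_parallel (n k : nat) (g : cube k -> cube n) (i : 'I_n) (j : 'I_k)
    (u : cube k) :
  injective g ->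
  (forall v w, [set v; w] \in edges (punctured_cube k) -> cube_adj (g v) (g w)) ->
  [set u; flip j u] \in edges (punctured_cube k) ->
  (flip i (g u) == g (flip j u)) =
  (flip i (g [ffun => false]) == g (flip j [ffun => false])).
Proof.
move=> g_inj g_adj.
(* The 4-cycle at [v] in directions [j] and [l] avoids the all-ones vertex, and injectivity of [g]
   keeps its image nondegenerate. *)
have step v l : l != j -> v != ones k -> flip j v != ones k ->
    flip l v != ones k -> flip j (flip l v) != ones k ->
    flip i (g v) = g (flip j v) -> flip i (g (flip l v)) = g (flip j (flip l v)).
  move=> neq_lj v1 jv1 lv1 jlv1 E.
  have neq : flip j v != flip l v.
    by apply: contraNneq neq_lj => /flip_inj_dir ->.
  symmetry; apply: (@square_parallel _ _ (g v)).
  - by apply: g_adj; rewrite flip_punctured v1.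
  - by rewrite E; apply: g_adj; rewrite flipC flip_punctured jv1 flipC.
  - by apply: g_adj; rewrite flip_punctured lv1.
  - rewrite (inj_eq g_inj); apply: contraNneq neq => {2}<-.
    by rewrite flipC flipK.
  - by rewrite E (inj_eq g_inj).
elim: {u}_.+1 {-2}u (ltnSn #|[set l | u l]|) => // m IHm u le_m.
rewrite flip_punctured => /andP[u1 ju1].
have [/existsP[l /andP[neq_lj ul]] | ] := boolP [exists l, (l != j) && u l].
  have off (v : cube k) : v l = false -> v != ones k.
    by move=> vl; apply/eqP => /ffunP/(_ l); rewrite ffunE vl.
  have lu1 : flip l u != ones k by apply: off; rewrite ffunE ul eqxx.
  have jlu1 : flip j (flip l u) != ones k.
    by apply: off; rewrite !ffunE ul eqxx (negPf neq_lj).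
  rewrite -(IHm (flip l u)) ?flip_punctured ?lu1 ?jlu1 //; last first.
    rewrite -ltnS; apply: leq_trans le_m; rewrite ltnS;
    apply/proper_card/properP; split.
      apply/subsetP => p; rewrite !inE ffunE.
      by case: eqP => [-> | _]; rewrite ?ul // addbF.
    by exists l; rewrite !inE ?ffunE ul ?eqxx.
  apply/eqP/eqP => E; first exact: step.
  (* The converse is the same step, taken from [flip l u] back to [u]. *)
  by rewrite -[u](flipK l); apply: step; rewrite ?flipK.
rewrite negb_exists => /forallP u_off.
have uE p : p != j -> u p = false.
  by move=> neq_pj; have := u_off p; rewrite neq_pj => /negPf.
(* Only bit [j] can still be on, so this is the edge at 0, possibly with its ends exchanged. *)
have [uj | /negPf uj] := boolP (u j).
  have -> : u = flip j [ffun => false].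
    apply/ffunP => p; rewrite !ffunE.
    by case: eqP => [-> | /eqP/uE].
  by rewrite flipK (can2_eq (flipK i) (flipK i)) eq_sym.
suff -> : u = [ffun => false] by [].
by apply/ffunP => p; rewrite ffunE; case: (eqVneq p j) => [-> | /uE].
Qed.

(** * Counting the edges in one direction *)

Definition dir_ends (n : nat) (C : graph (cube n)) (i : 'I_n) : {set cube n} :=
  [set x | [set x; flip i x] \in edges C].

Lemma edge_vertices (T : finType) (G : graph T) (e : {set T}) :
  e \in edges G -> e \subset vertices G.
Proof. by case: G => G G_ok eG; move/forall_inP: (G_ok) => /(_ e eG)/andP[]. Qed.

(** By [copy_parallel], each direction of the punctured cube is sent to direction [i] entirely or
    not at all. Pulled back to [cube k], the ends thus form a disjoint union of classes of size 2^k
    - 2. *)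
Lemma dvdn_dir_ends (n k : nat) (C : graph (cube n)) (i : 'I_n) :
  is_copy (punctured_cube k) (hypercube n) C -> 2 ^ k - 2 %| #|dir_ends C i|.
Proof.
case=> /andP[_ /subsetP edgesC] [f [f_inj f_im f_edge]].
have /fin_all_exists2[g gV fK] u : exists2 x, x \in vertices C & f x = u.
  have : u \in f @: vertices C by rewrite f_im inE.
  by case/imsetP => x xV ->; exists x.
have g_inj : injective g := can_inj fK.
have gK x : x \in vertices C -> g (f x) = x by move=> xV; apply: f_inj.
have g_edge u v : ([set u; v] \in edges (punctured_cube k)) =
                  ([set g u; g v] \in edges C) by rewrite f_edge ?fK.
have g_adj u v : [set u; v] \in edges (punctured_cube k) -> cube_adj (g u) (g v).
  by rewrite g_edge => /edgesC; rewrite in_cube_edges.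
pose B j := [set u | [set u; flip j u] \in edges (punctured_cube k)
                     & flip i (g u) == g (flip j u)].
have -> : #|dir_ends C i| = #|\bigcup_j B j|.
  rewrite -(card_imset _ g_inj); congr #|pred_of_set _|; apply/setP => x.
  apply/idP/imsetP => [|[u /bigcupP[j _]]].
    rewrite inE => xC; have /subsetP eV := edge_vertices xC.
    have xV := eV _ (set21 _ _); have yV := eV _ (set22 _ _).
    exists (f x); last by rewrite gK.
    have fxy : [set f x; f (flip i x)] \in edges (punctured_cube k).
      by rewrite -f_edge.
    move: (fxy); rewrite [edges _]/= in_set in_cube_edges.
    case/andP => /cube_adjP[j fyE] _.
    by apply/bigcupP; exists j; rewrite // inE -fyE fxy !gK /=.
  rewrite inE => /andP[uC /eqP guE] ->.
  by rewrite inE guE -g_edge.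
(* The neighbour of [g u] in direction [i] is a single vertex, so injectivity of [g] determines
   [j]. *)
have disj j l : j != l -> [disjoint B j & B l].
  move=> neq_jl; rewrite -setI_eq0; apply/eqP/setP => u; rewrite !inE.
  apply: contraNF neq_jl => /andP[/andP[_ /eqP->] /andP[_ /eqP/g_inj E]].
  by rewrite (flip_inj_dir E).
rewrite -sum1_card partition_disjoint_bigcup //.
apply: dvdn_sum => j _; rewrite sum1_card.
(* The edge at 0 decides whether [B j] is a full class or empty. *)
have [E0 | /negPf E0] :=
  boolP (flip i (g [ffun => false]) == g (flip j [ffun => false])).
  rewrite (_ : B j = [set u | [set u; flip j u] \in edges (punctured_cube k)]).
    by rewrite card_flip_punctured.
  apply/setP => u; rewrite [LHS]in_set [RHS]in_set; apply: andb_idr => uH.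
  by rewrite (copy_parallel _ g_inj g_adj).
rewrite (_ : B j = set0) ?cards0 //; apply/setP => u; rewrite in_set in_set0.
by apply/andP => -[uH]; rewrite (copy_parallel _ g_inj g_adj) // E0.
Qed.

(** Double counting: each vertex [x] contributes exactly once, through the unique member of [F]
    containing its edge in direction [i]. *)
Lemma sum_dir_ends (n : nat) (F : {set graph (cube n)}) (i : 'I_n) :
  {in F &, forall C D, C != D -> [disjoint edges C & edges D]} ->
  \bigcup_(C in F) edges C = edges (hypercube n) ->
  \sum_(C in F) #|dir_ends C i| = 2 ^ n.
Proof.
move=> disjF coverF.
transitivity (\sum_(C in F) \sum_(x : cube n) ([set x; flip i x] \in edges C)).
  apply: eq_bigr => C _; rewrite -sum1_card big_mkcond.
  by apply: eq_bigr => x _; rewrite inE; case: (_ \in _).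
rewrite exchange_big /=.
rewrite -[in RHS](card_ord n) -card_bool -card_ffun -sum1_card.
apply: eq_bigr => x _.
have : [set x; flip i x] \in edges (hypercube n) by apply: flip_edge.
rewrite -coverF => /bigcupP[C CF xC].
rewrite (bigD1 C) //= xC big1 ?addn0 // => D /andP[DF neq_DC].
have := disjointFl (disjF D C DF CF neq_DC) xC.
by move->.
Qed.

(** A positive [n] supplies a direction to count in; for [n = 0] the empty family is a
    decomposition. The bound on [k] makes the odd divisor 2^(k-1) - 1 exceed 1. *)
Lemma punctured_cube_not_decomposable (n k : nat) :
  2 < k -> 0 < n -> ~ edge_decomposable (hypercube n) (punctured_cube k).
Proof.
case: k => // k; rewrite ltnS => k_gt1 n_gt0 [F [copyF disjF coverF]].
have : 2 ^ k.+1 - 2 %| 2 ^ n.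
  rewrite -(sum_dir_ends (Ordinal n_gt0) disjF coverF).
  by apply: dvdn_sum => C /copyF/dvdn_dir_ends.
have -> : 2 ^ k.+1 - 2 = 2 * (2 ^ k - 1) by rewrite expnS mulnBr muln1.
(* Here [k] is one less than in the statement. The odd factor 2^k - 1 is coprime to 2^n and divides
   it, hence equals 1, against 2^k >= 4. *)
move/(dvdn_trans (dvdn_mull 2 (dvdnn _))).
have k_gt0 : 0 < k by apply: ltnW.
have odd_q : odd (2 ^ k - 1).
  by rewrite oddB ?expn_gt0 // oddX /= eqn0Ngt k_gt0.
have co_q : coprime (2 ^ k - 1) (2 ^ n) by rewrite coprimeXr // coprimen2.
move/gcdn_idPl; move/eqP: co_q => -> q1.
have : 2 ^ 2 <= 2 ^ k by rewrite leq_exp2l.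
by rewrite -(subnK (_ : 0 < 2 ^ k)) ?expn_gt0 // -q1.
Qed.

(** * A smaller cube inside the punctured cube *)

Definition facet (k : nat) : {set cube k.+1} := [set u : cube k.+1 | ~~ u ord0].

Lemma facet_edgesP (k : nat) :
  [forall e in [set e in cube_edges k.+1 | e \subset facet k],
     (e \subset facet k) && (#|e| == 2)].
Proof.
apply/forall_inP => e; rewrite in_set => /andP[e_edge ->] /=.
by move/forall_inP: (cube_edgesP k.+1) => /(_ _ e_edge)/andP[].
Qed.

Definition facet_graph (k : nat) : graph (cube k.+1) :=
  @Graph _ (facet k, [set e in cube_edges k.+1 | e \subset facet k])
    (facet_edgesP k).

(** A facet with bit [ord0] off misses the all-ones vertex, so none of its edges was removed;
    dropping that bit is the isomorphism. *)
Lemma facet_copy (k : nat) :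
  is_copy (hypercube k) (punctured_cube k.+1) (facet_graph k).
Proof.
split.
  apply/andP; split; first exact: subsetT.
  apply/subsetP => e; rewrite [edges _]/= !in_set => /andP[-> /subsetP eV] /=.
  by apply/negP => /eV; rewrite inE ffunE.
exists (fun u : cube k.+1 => [ffun i => u (lift ord0 i)] : cube k).
split=> /=.
- move=> x y; rewrite !inE => /negPf x0 /negPf y0 /ffunP E.
  apply/ffunP => i; have [j ->|->] := unliftP ord0 i; last by rewrite x0 y0.
  by have := E j; rewrite !ffunE.
- apply/setP => v; rewrite inE; apply/imsetP.
  exists [ffun i => if unlift ord0 i is Some j then v j else false].
    by rewrite inE ffunE unlift_none.
  by apply/ffunP => j; rewrite !ffunE liftK.
- move=> x y xV yV; rewrite [edges _]/= in_set [edges _]/= !in_cube_edges.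
  rewrite subUset !sub1set xV yV !andbT.
  move: xV yV; rewrite !inE => /negPf x0 /negPf y0.
  (* Bit [ord0] agrees on the facet, so the differing coordinates all lie in the image of
     [lift ord0]. *)
  rewrite /cube_adj -[in RHS](card_imset _ (@lift_inj _ (ord0 : 'I_k.+1))).
  congr (_ == 1); congr #|pred_of_set _|; apply/setP => i; rewrite inE.
  apply/idP/imsetP => [|[j]]; last by rewrite inE !ffunE => ? ->.
  have [j -> xy|->] := unliftP ord0 i; last by rewrite x0 y0.
  by exists j; rewrite // inE !ffunE.
Qed.

Theorem theorem1p7 (k : nat) (hk : 5 <= k) :
  exists H : graph (cube k),
    [/\ subgraph H (hypercube k),
        exists C : graph (cube k), is_copy (hypercube k.-1) H C
      & forall n : nat, 0 < n -> ~ edge_decomposable (hypercube n) H].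
Proof.
exists (punctured_cube k); split.
- apply/andP; split; first exact: subsetT.
  by apply/subsetP => e; rewrite in_set => /andP[].
- by case: k hk => // k _; exists (facet_graph k); apply: facet_copy.
- by move=> n; apply: punctured_cube_not_decomposable; apply: leq_trans hk.
Qed.
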